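(* Let $R$ be a commutative ring, $A,B$ finite $R$-modules, $C$ a cyclic group of odd order $r$, and $\lambda:A\times B\to C$ a $\mathbb{Z}$-bilinear, $R$-balanced, non-degenerate pairing, with $A\neq 0$. Let $\mathcal{H}=\mathcal{H}(A,B,C,\lambda)$. For $\phi\in\mathrm{Aut}^0_R(\mathcal{H})$ define $\eta_\phi:A\oplus B\to C$ by $\phi(\mathcal{D}(\mathbf{a}))=\mathcal{D}(\bar\phi(\mathbf{a}))\,m(\eta_\phi(\mathbf{a}))$ for all $\mathbf{a}\in A\oplus B$. Then each $\eta_\phi$ lies in $\mathrm{Hom}(A\oplus B,C)$, each $\bar\phi$ lies in $\mathrm{Sp}_R(A\oplus B;\delta)$, and the map $\Theta_{\mathcal{D}}:\mathrm{Aut}^0_R(\mathcal{H})\to \mathrm{Hom}(A\oplus B,C)\rtimes \mathrm{Sp}_R(A\oplus B;\delta)$, $\phi\mapsto(\eta_\phi,\bar\phi^{-1})$, is a group anti-isomorphism.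
   Context: $\mathcal{H}(A,B,C,\lambda)$ is the set $A\times B\times C$ with elements written $h(a,b,c)$ and multiplication $h(a,b,c)h(a',b',c')=h(a+a',b+b',c+c'+\lambda(a,b'))$. $R$-balanced means $\lambda(ra,b)=\lambda(a,rb)$; non-degenerate means the left and right kernels of $\lambda$ are zero. Let $m:C\to\mathcal{H}$, $c\mapsto h(0,0,c)$; under these hypotheses $m(C)$ is the centre $Z$ of $\mathcal{H}$ and $\mathcal{H}/Z$ is identified with $A\oplus B$ via $h(a,b,c)\mapsto (a,b)$. For $\phi\in\mathrm{Aut}(\mathcal{H})$, $\bar\phi$ is the induced automorphism of $\mathcal{H}/Z=A\oplus B$. $\mathrm{Aut}^0_R(\mathcal{H})$ is the group of automorphisms of $\mathcal{H}$ fixing $Z$ elementwise and with $\bar\phi$ $R$-linear. Define $\delta:(A\oplus B)^2\to C$ by $\delta((a,b),(a',b'))=\lambda(a,b')-\lambda(a',b)$, and $\mathrm{Sp}_R(A\oplus B;\delta)$ = the set of $R$-linear automorphisms $\alpha$ of $A\oplus B$ with $\delta(\alpha\mathbf{a},\alpha\mathbf{a}')=\delta(\mathbf{a},\mathbf{a}')$ for all $\mathbf{a},\mathbf{a}'$. Since $r$ is odd, each $c\in C$ has a unique half $\tfrac12 c$; define $\mathcal{D}:A\oplus B\to\mathcal{H}$ by $\mathcal{D}((a,b))=h(a,b,\tfrac12\lambda(a,b))$. The semidirect product $\mathrm{Hom}(A\oplus B,C)\rtimes\mathrm{Sp}_R(A\oplus B;\delta)$ has underlying set the product and multiplication $(\eta_1,\alpha_1)\cdot(\eta_2,\alpha_2)=(\eta_1+\eta_2\circ\alpha_1^{-1},\alpha_1\circ\alpha_2)$.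 An anti-isomorphism is a bijection $\Theta$ with $\Theta(xy)=\Theta(y)\Theta(x)$. *)

(* Defs.v *)
From HB Require Import structures.
From mathcomp Require Import all_boot all_order all_algebra all_fingroup.
From mathcomp Require Import all_solvable.
From mathcomp Require Import boolp.

Set Implicit Arguments.
Unset Strict Implicit.
Unset Printing Implicit Defensive.

Import GRing.Theory.

Local Open Scope ring_scope.

Definition anti_isomorphism (G H : groupType) (f : G -> H) : Prop :=
  bijective f /\ {morph f : x y / (x * y)%g >-> (y * x)%g}.

(* The product of {perm T} applies its left factor first; comp_perm is the    *)
(* composition of functions.                                                  *)
Definition comp_perm (T : finType) (s t : {perm T}) : {perm T} := (t * s)%g.

Lemma comp_permE (T : finType) (s t : {perm T}) x : comp_perm s t x = s (t x).
Proof. by rewrite /comp_perm permM. Qed.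

Section Half.
Variable C : finZmodType.

(* The solution d of 2d = c, which exists and is unique when #|C| is odd     *)
(* (halveP); junk value 0 if there is none.                                   *)
Definition halve (c : C) : C := odflt 0 [pick d | d *+ 2 == c].

Lemma mulr2_inj : odd #|C| -> injective (fun d : C => d *+ 2).
Proof.
move=> oddC x y /= eqxy; set n := #|C|./2.
have C0 (d : C) : d *+ #|C| = 0.
  have /= := @expg_cardG _ [group of [set: C]] d (in_setT d).
  by rewrite cardsT FinRing.zmodXgE.
have E (d : C) : d = - (d *+ 2 *+ n).
  apply/eqP; rewrite -addr_eq0 -mulrnA mul2n -mulrS.
  by have := odd_double_half #|C|; rewrite oddC add1n -/n => ->; rewrite C0.
by rewrite (E x) eqxy -E.
Qed.

Lemma halveP : odd #|C| -> forall c d : C, (d *+ 2 = c) <-> (d = halve c).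
Proof.
move=> oddC c d; have inj := mulr2_inj oddC; have [g gK Kg] := injF_bij inj.
have hK : halve c *+ 2 = c.
  rewrite /halve; case: pickP => [e /eqP //|no].
  by have := no (g c); rewrite Kg eqxx.
by split=> [dc|-> //]; apply: inj; rewrite /= hK.
Qed.

End Half.

(* Z-bilinear maps A x B -> C. *)
Record pairing (A B C : zmodType) := Pairing {
  pairing_fun :> A -> B -> C;
  pairingDl : forall b, {morph pairing_fun^~ b : x y / x + y};
  pairingDr : forall a, {morph pairing_fun a : x y / x + y} }.

Section PairingTheory.
Variables (A B C : zmodType) (lam : pairing A B C).

Lemma pairing0l b : lam 0 b = 0.
Proof. by apply: (addrI (lam 0 b)); rewrite -pairingDl !addr0. Qed.

Lemma pairing0r a : lam a 0 = 0.
Proof. by apply: (addrI (lam a 0)); rewrite -pairingDr !addr0. Qed.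

Lemma pairingNl a b : lam (- a) b = - lam a b.
Proof. by apply/eqP; rewrite -addr_eq0 -pairingDl addNr pairing0l. Qed.

Lemma pairingNr a b : lam a (- b) = - lam a b.
Proof. by apply/eqP; rewrite -addr_eq0 -pairingDr addNr pairing0r. Qed.

Definition nondegenerate_pairing : Prop :=
  (forall a, (forall b, lam a b = 0) -> a = 0) /\
  (forall b, (forall a, lam a b = 0) -> b = 0).

End PairingTheory.

Definition balanced_pairing (R : comNzRingType) (A B : lmodType R) (C : zmodType)
    (lam : pairing A B C) : Prop :=
  forall (r : R) (a : A) (b : B), lam (r *: a) b = lam a (r *: b).

Section Heisenberg.
Variables (R : comNzRingType) (A B : finLmodType R) (C : finZmodType).
Variable lam : pairing A B C.

Local Notation V := (A * B)%type.

Record heis := Heis { heisA : A; heisB : B; heisC : C }.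

Definition prod_of_heis (x : heis) : A * B * C := (heisA x, heisB x, heisC x).
Definition heis_of_prod (x : A * B * C) : heis := Heis x.1.1 x.1.2 x.2.
Lemma prod_of_heisK : cancel prod_of_heis heis_of_prod.
Proof. by case. Qed.

HB.instance Definition _ := Finite.copy heis (can_type prod_of_heisK).

Definition heis_mul (x y : heis) : heis :=
  Heis (heisA x + heisA y) (heisB x + heisB y)
       (heisC x + heisC y + lam (heisA x) (heisB y)).
Definition heis_one : heis := Heis 0 0 0.
Definition heis_inv (x : heis) : heis :=
  Heis (- heisA x) (- heisB x) (- heisC x + lam (heisA x) (heisB x)).

Fact heis_mulA : associative heis_mul.
Proof.
move=> [a b c] [a' b' c'] [a'' b'' c'']; rewrite /heis_mul /=.
rewrite pairingDl pairingDr; congr Heis; rewrite ?addrA //.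
by rewrite [LHS](ACl (1*2*5*3*6*4))%AC.
Qed.

Fact heis_mul1 : left_id heis_one heis_mul.
Proof. by case=> a b c; rewrite /heis_mul /= !add0r pairing0l addr0. Qed.

Fact heis_mulV : left_inverse heis_one heis_inv heis_mul.
Proof.
case=> a b c; rewrite /heis_mul /= !addNr pairingNl.
by rewrite addrAC addrK addNr.
Qed.

HB.instance Definition _ :=
  Finite_isGroup.Build heis heis_mulA heis_mul1 heis_mulV.

Definition mC (c : C) : heis := Heis 0 0 c.

(* The quotient map H -> H/Z, under the identification of H/Z with A + B;     *)
(* see heisV_ker and center_heis.                                             *)
Definition heisV (x : heis) : V := (heisA x, heisB x).

Lemma heisVM : {morph heisV : x y / (x * y)%g >-> x + y}.
Proof. by []. Qed.

Lemma heisV_surj v : exists x, heisV x = v.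
Proof. by exists (Heis v.1 v.2 0); case: v. Qed.

Lemma heisV_ker x : heisV x = 0 <-> x \in [set mC c | c : C].
Proof.
split=> [|/imsetP[c _ ->] //]; case: x => a b c [-> ->].
exact: imset_f.
Qed.

Lemma heis_mC (x : heis) : x = (Heis (heisA x) (heisB x) 0 * mC (heisC x))%g.
Proof.
by case: x => a b c; congr Heis; rewrite /= ?addr0 // pairing0r add0r addr0.
Qed.

Lemma mC_center c : mC c \in 'Z([set: heis])%g.
Proof.
rewrite inE in_setT; apply/centP => -[a b d] _.
by congr Heis; rewrite /= ?addr0 ?add0r // pairing0l pairing0r !addr0 addrC.
Qed.

Lemma center_heis :
  nondegenerate_pairing lam -> ('Z([set: heis]))%g = [set mC c | c : C].
Proof.
move=> [ndl ndr]; apply/setP => x; apply/idP/imsetP => [|[c _ ->]]; last first.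
  exact: mC_center.
rewrite inE in_setT /= => /centP xC; exists (heisC x) => //.
case: x xC => a b c xC; congr Heis.
- apply: ndl => b'.
  have /(congr1 heisC)/= := xC (Heis 0 b' 0) (in_setT _).
  by rewrite !addr0 pairing0l addr0 add0r => /(canRL (addKr _)); rewrite addNr.
- apply: ndr => a'.
  have /(congr1 heisC)/= := xC (Heis a' 0 0) (in_setT _).
  rewrite !addr0 pairing0r addr0 add0r => /esym/(canRL (addKr _)).
  by rewrite addNr.
Qed.

(* The map induced on A + B by phi, computed on the representative h(a,b,0);  *)
(* heisV_bar shows that any representative gives the same value.              *)
Definition bar_fun (phi : heis -> heis) (v : V) : V :=
  heisV (phi (Heis v.1 v.2 0)).

(* The classical truth value is needed because R may be infinite.             *)
Definition in_aut0 : {pred {perm heis}} := fun phi =>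
  [&& phi \in Aut [set: heis],
      [forall z in 'Z([set: heis])%g, phi z == z]
    & `[< linear (bar_fun phi) >]].

Record aut0 := Aut0 { aut0_perm :> {perm heis}; aut0P : in_aut0 aut0_perm }.

HB.instance Definition _ := [isSub for aut0_perm].
HB.instance Definition _ := [Finite of aut0 by <:].

Lemma in_aut0P (phi : {perm heis}) :
  reflect [/\ {morph phi : x y / (x * y)%g},
              {in 'Z([set: heis])%g, phi =1 id}
            & linear (bar_fun phi)]
          (in_aut0 phi).
Proof.
apply: (iffP and3P) => [[Aphi /forall_inP Zphi /asboolP Lphi]|[M Z L]].
  split=> // [x y|z /Zphi/eqP //].
  move: Aphi; rewrite inE => /andP[_ /morphicP]; apply; exact: in_setT.
split; last exact/asboolP; last by apply/forall_inP => z /Z ->.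
rewrite inE; apply/andP; split; last by apply/morphicP => x y _ _; apply: M.
by apply/subsetP => x _; apply: in_setT.
Qed.

Lemma heisV_bar_subproof (phi : {perm heis}) (x : heis) :
  in_aut0 phi -> heisV (phi x) = bar_fun phi (heisV x).
Proof.
case/in_aut0P=> M Z _; rewrite {1}(heis_mC x) M heisVM (Z (mC _)) ?mC_center //.
by rewrite [heisV (mC _)](_ : _ = 0) // addr0.
Qed.

Lemma bar_funM (s t : {perm heis}) :
  in_aut0 s -> in_aut0 t ->
  bar_fun (comp_perm s t) =1 bar_fun s \o bar_fun t.
Proof.
by move=> s0 t0 v; rewrite /bar_fun comp_permE heisV_bar_subproof.
Qed.

Fact aut0_one_subproof : in_aut0 1%g.
Proof.
apply/in_aut0P; split=> [x y|z _|r x y]; rewrite ?perm1 //.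
by rewrite /bar_fun !perm1.
Qed.

Fact aut0_mul_subproof (s t : aut0) : in_aut0 (comp_perm s t).
Proof.
have [[sM sZ sL] [tM tZ tL]] := (in_aut0P _ (aut0P s), in_aut0P _ (aut0P t)).
apply/in_aut0P; split=> [x y|z Zz|r x y]; rewrite ?comp_permE ?tM ?sM //.
  by rewrite tZ // sZ.
by rewrite !bar_funM ?aut0P //= tL sL.
Qed.

Lemma bar_funV (s : {perm heis}) :
  in_aut0 s -> {morph s^-1%g : x y / (x * y)%g} ->
  {in 'Z([set: heis])%g, s^-1%g =1 id} ->
  cancel (bar_fun s) (bar_fun s^-1%g) /\ cancel (bar_fun s^-1%g) (bar_fun s).
Proof.
move=> s0 VM VZ.
have VV x : heisV (s^-1%g x) = bar_fun s^-1%g (heisV x).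
  rewrite {1}(heis_mC x) VM heisVM (VZ (mC _)) ?mC_center //.
  by rewrite [heisV (mC _)](_ : _ = 0) // addr0.
split=> v; rewrite {2}/bar_fun.
  by rewrite -VV permK; case: v.
by rewrite -heisV_bar_subproof // permKV; case: v.
Qed.

Lemma aut0V_props (s : aut0) :
  {morph (aut0_perm s)^-1%g : x y / (x * y)%g} /\
  {in 'Z([set: heis])%g, (aut0_perm s)^-1%g =1 id}.
Proof.
have [sM sZ sL] := in_aut0P _ (aut0P s); split=> [x y|z Zz].
  by apply: (@perm_inj _ s); rewrite sM !permKV.
by apply: (@perm_inj _ s); rewrite permKV sZ.
Qed.

Fact aut0_inv_subproof (s : aut0) : in_aut0 (aut0_perm s)^-1%g.
Proof.
have [sM sZ sL] := in_aut0P _ (aut0P s); have [VM VZ] := aut0V_props s.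
apply/in_aut0P; split=> // r x y.
have [K VK] := bar_funV (aut0P s) VM VZ.
by apply: (can_inj K); rewrite VK sL !VK.
Qed.

Definition aut0_one : aut0 := Aut0 aut0_one_subproof.
Definition aut0_mul (s t : aut0) : aut0 := Aut0 (aut0_mul_subproof s t).
Definition aut0_inv (s : aut0) : aut0 := Aut0 (aut0_inv_subproof s).

Fact aut0_mulA : associative aut0_mul.
Proof. by move=> s t u; apply: val_inj; rewrite /= /comp_perm mulgA. Qed.
Fact aut0_mul1 : left_id aut0_one aut0_mul.
Proof. by move=> s; apply: val_inj; rewrite /= /comp_perm mulg1. Qed.
Fact aut0_mulV : left_inverse aut0_one aut0_inv aut0_mul.
Proof. by move=> s; apply: val_inj; rewrite /= /comp_perm mulgV. Qed.

HB.instance Definition _ :=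
  Finite_isGroup.Build aut0 aut0_mulA aut0_mul1 aut0_mulV.

Lemma aut0M (phi psi : aut0) x : (phi * psi)%g x = phi (psi x).
Proof. exact: comp_permE. Qed.

Fact bar_inj (phi : aut0) : injective (bar_fun phi).
Proof.
have [VM VZ] := aut0V_props phi.
by have [K _] := bar_funV (aut0P phi) VM VZ; apply: can_inj K.
Qed.

Definition bar (phi : aut0) : {perm V} := perm (@bar_inj phi).

Lemma heisV_bar (phi : aut0) x : heisV (phi x) = bar phi (heisV x).
Proof. by rewrite permE heisV_bar_subproof ?aut0P. Qed.

Definition delta (u v : V) : C := lam u.1 v.2 - lam v.1 u.2.

Definition Dsec (v : V) : heis := Heis v.1 v.2 (halve (lam v.1 v.2)).

Lemma heisV_Dsec v : heisV (Dsec v) = v.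
Proof. by case: v. Qed.

(* The c such that phi (D v) = D (bar phi v) m(c); it always exists and is    *)
(* unique (eta_ofP).                                                          *)
Definition eta_of (phi : aut0) : {ffun V -> C} :=
  [ffun v => odflt 0 [pick c | phi (Dsec v) == (Dsec (bar phi v) * mC c)%g]].

Lemma eta_ofP (phi : aut0) (v : V) (c : C) :
  phi (Dsec v) = (Dsec (bar phi v) * mC c)%g <-> c = eta_of phi v.
Proof.
have uniq d e : (Dsec (bar phi v) * mC d = Dsec (bar phi v) * mC e)%g -> d = e.
  by move/mulgI => -[].
have ex : phi (Dsec v) = (Dsec (bar phi v) * mC (eta_of phi v))%g.
  rewrite ffunE; case: pickP => [d /eqP //|no].
  set x := phi (Dsec v) in no *; set y := Dsec _ in no *.
  have xy : heisV x = heisV y by rewrite heisV_bar !heisV_Dsec.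
  have /heisV_ker/imsetP[d _ yx] : heisV (y^-1 * x)%g = 0.
    by rewrite heisVM xy -heisVM mulVg.
  by have := no d; rewrite -yx mulKVg eqxx.
by split=> [E|->//]; apply: uniq; rewrite -E.
Qed.

(* homV is Hom(A + B, C): additive maps, as C is only an abelian group.       *)
Definition hom_pred : {pred {ffun V -> C}} := fun f => `[< zmod_morphism f >].

Record homV := HomV { homV_fun :> {ffun V -> C}; homVP : homV_fun \in hom_pred }.

HB.instance Definition _ := [isSub for homV_fun].
HB.instance Definition _ := [Finite of homV by <:].

Fact hom_zmod_closed : zmod_closed hom_pred.
Proof.
split=> [|f g /asboolP fP /asboolP gP]; apply/asboolP => x y; rewrite !ffunE.
  by rewrite subr0.
by rewrite fP gP !opprD !addrA; congr (_ + _); rewrite -!addrA;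
   congr (_ + _); rewrite addrC.
Qed.
HB.instance Definition _ :=
  GRing.isZmodClosed.Build {ffun V -> C} hom_pred hom_zmod_closed.
HB.instance Definition _ := [SubChoice_isSubZmodule of homV by <:].

Lemma homVD (f g : homV) v : (f + g) v = f v + g v.
Proof. by rewrite -[homV_fun (f + g)]/(val (f + g)) raddfD ffunE. Qed.

(* spV is Sp_R(A + B; delta), a group under composition (spVM).               *)
Definition sp_pred : {pred {perm V}} := fun alpha =>
  `[< linear alpha /\
      forall u v, delta (alpha u) (alpha v) = delta u v >].

Record spV := SpV { spV_perm :> {perm V}; spVP : spV_perm \in sp_pred }.

HB.instance Definition _ := [isSub for spV_perm].
HB.instance Definition _ := [Finite of spV by <:].

Fact spV_one_subproof : 1%g \in sp_pred.
Proof. by apply/asboolP; split=> [r x y|u v]; rewrite !perm1. Qed.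

Fact spV_mul_subproof (s t : spV) : comp_perm s t \in sp_pred.
Proof.
have [[sL sD] [tL tD]] := (asboolP _ (spVP s), asboolP _ (spVP t)).
by apply/asboolP; split=> [r x y|u v]; rewrite !comp_permE ?tL ?sL // sD tD.
Qed.

Fact spV_inv_subproof (s : spV) : (spV_perm s)^-1%g \in sp_pred.
Proof.
have [sL sD] := asboolP _ (spVP s).
apply/asboolP; split=> [r x y|u v]; last by rewrite -sD !permKV.
by apply: (@perm_inj _ s); rewrite sL !permKV.
Qed.

Definition spV_one : spV := SpV spV_one_subproof.
Definition spV_mul (s t : spV) : spV := SpV (spV_mul_subproof s t).
Definition spV_inv (s : spV) : spV := SpV (spV_inv_subproof s).

Fact spV_mulA : associative spV_mul.
Proof. by move=> s t u; apply: val_inj; rewrite /= /comp_perm mulgA. Qed.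
Fact spV_mul1 : left_id spV_one spV_mul.
Proof. by move=> s; apply: val_inj; rewrite /= /comp_perm mulg1. Qed.
Fact spV_mulV : left_inverse spV_one spV_inv spV_mul.
Proof. by move=> s; apply: val_inj; rewrite /= /comp_perm mulgV. Qed.

HB.instance Definition _ :=
  Finite_isGroup.Build spV spV_mulA spV_mul1 spV_mulV.

Lemma spVM (s t : spV) x : (s * t)%g x = s (t x).
Proof. exact: comp_permE. Qed.

Fact hom_comp_subproof (f : homV) (s : spV) : [ffun x => f (s x)] \in hom_pred.
Proof.
have [[sL _] fP] := (asboolP _ (spVP s), asboolP _ (homVP f)).
apply/asboolP => x y; rewrite !ffunE -fP.
by congr (f _); rewrite addrC -scaleN1r sL scaleN1r addrC.
Qed.

Definition hom_comp (f : homV) (s : spV) : homV := HomV (hom_comp_subproof f s).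

Lemma hom_compE (f : homV) (s : spV) v : hom_comp f s v = f (s v).
Proof. exact: ffunE. Qed.

(* homSp is the semidirect product of homV by spV.                            *)
Record homSp := HomSp { homSp_hom : homV; homSp_sp : spV }.

Definition prod_of_homSp (x : homSp) := (homSp_hom x, homSp_sp x).
Definition homSp_of_prod (x : homV * spV) := HomSp x.1 x.2.
Lemma prod_of_homSpK : cancel prod_of_homSp homSp_of_prod.
Proof. by case. Qed.

HB.instance Definition _ := Finite.copy homSp (can_type prod_of_homSpK).

Definition homSp_one : homSp := HomSp 0 1%g.
Definition homSp_mul (x y : homSp) : homSp :=
  HomSp (homSp_hom x + hom_comp (homSp_hom y) (homSp_sp x)^-1%g)
        (homSp_sp x * homSp_sp y)%g.
Definition homSp_inv (x : homSp) : homSp :=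
  HomSp (- hom_comp (homSp_hom x) (homSp_sp x)) (homSp_sp x)^-1%g.

Fact homSp_mulA : associative homSp_mul.
Proof.
move=> [f s] [g t] [h u]; rewrite /homSp_mul /= mulgA; congr HomSp.
apply: val_inj; apply/ffunP => x.
by rewrite !(homVD, hom_compE) invMg spVM addrA.
Qed.

Fact homSp_mul1 : left_id homSp_one homSp_mul.
Proof.
move=> [f s]; rewrite /homSp_mul /= mul1g add0r; congr HomSp.
by apply: val_inj; apply/ffunP => x; rewrite hom_compE invg1 [_ x]perm1.
Qed.

Fact homSp_mulV : left_inverse homSp_one homSp_inv homSp_mul.
Proof.
move=> [f s]; rewrite /homSp_mul /= mulVg; congr HomSp.
by rewrite invgK addNr.
Qed.

HB.instance Definition _ :=
  Finite_isGroup.Build homSp homSp_mulA homSp_mul1 homSp_mulV.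

End Heisenberg.

Arguments hom_pred {R A B C}.

(* Main.v *)
(* As #|C| is odd, the section D satisfies D(u) D(v) = D(u+v) m(delta(u,v)/2),
   and therefore D(u) D(v) = D(v) D(u) m(delta(u,v)).  Applying phi to the second
   identity shows that bar phi preserves delta; then applying it to the first
   shows that eta_phi is additive.  Every element is uniquely D(v) m(c), and phi
   sends it to D(bar phi v) m(eta_phi(v) + c): hence phi is determined by
   (eta_phi, bar phi), and for any additive eta and any alpha in Sp the formula
   D(v) m(c) |-> D(alpha v) m(eta(v) + c) defines an element of Aut^0_R. *)
Require Import Defs.
From HB Require Import structures.
From mathcomp Require Import all_boot all_order all_algebra all_fingroup.
From mathcomp Require Import all_solvable.
From mathcomp Require Import boolp.

Import GRing.Theory.
Local Open Scope ring_scope.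

(** * Halving in an abelian group of odd order *)

Section Halve.
Set Implicit Arguments.
Unset Strict Implicit.
Variables (C : finZmodType) (oddC : odd #|C|).

Lemma halve_mulr2 (c : C) : halve c *+ 2 = c.
Proof. exact/(halveP oddC). Qed.

Lemma halve0 : halve (0 : C) = 0.
Proof. by apply/esym/(halveP oddC); rewrite mul0rn. Qed.

Lemma halveD (c d : C) : halve (c + d) = halve c + halve d.
Proof. by apply/esym/(halveP oddC); rewrite mulrnDl !halve_mulr2. Qed.

Lemma halveN (c : C) : halve (- c) = - halve c.
Proof. by apply/esym/(halveP oddC); rewrite mulNrn halve_mulr2. Qed.

End Halve.

(** The inverse is picked by classical choice, so no formula for it is needed. *)
Lemma surj_inj_bij (T U : Type) (f : T -> U) :
  injective f -> (forall y, exists x, f x = y) -> bijective f.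
Proof.
move=> f_inj f_surj; exists (fun y => projT1 (cid (f_surj y))) => [x|y].
  by apply: f_inj; case: cid.
by case: cid.
Qed.

Section HeisenbergAutomorphisms.
Set Implicit Arguments.
Unset Strict Implicit.
Variables (R : comNzRingType) (A B : finLmodType R) (C : finZmodType).
Variables (lam : pairing A B C) (oddC : odd #|C|).

Local Notation V := (A * B)%type.
Local Notation D := (Dsec lam).
Local Notation m := (mC A B).
(* The type heis does not mention lam, so the generic group product cannot
   infer which pairing it is built on. *)
Local Notation "x *h y" := (heis_mul lam x y) (at level 40, left associativity).

(** * The normal form [D v *h m c] and its multiplication *)

Lemma mCD (c d : C) : m (c + d) = m c *h m d.
Proof. by rewrite /heis_mul /= pairing0l !addr0. Qed.

Lemma mC_comm (c : C) (x : heis A B C) : m c *h x = x *h m c.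
Proof.
case: x => a b d.
by rewrite /heis_mul /= pairing0l pairing0r !addr0 !add0r addrC.
Qed.

Lemma Dsec_mCE (v : V) (c : C) :
  D v *h m c = Heis v.1 v.2 (halve (lam v.1 v.2) + c).
Proof. by rewrite /heis_mul /= pairing0r !addr0. Qed.

Lemma Dsec_mC_inj (u v : V) (c d : C) :
  D u *h m c = D v *h m d -> u = v /\ c = d.
Proof.
rewrite !Dsec_mCE; case: u v => [a b] [a' b'] /= [-> ->].
by move/addrI.
Qed.

(** The central coordinate of the normal form; the other coordinate is [heisV x]. *)
Definition Dcoord (x : heis A B C) : C :=
  heisC x - halve (lam (heisA x) (heisB x)).

Lemma Dsec_decomp (x : heis A B C) : x = D (heisV x) *h m (Dcoord x).
Proof. by rewrite Dsec_mCE /Dcoord addrC subrK; case: x. Qed.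

Lemma Dcoord_Dsec (v : V) (c : C) : Dcoord (D v *h m c) = c.
Proof. by rewrite Dsec_mCE /Dcoord /= addrC addKr. Qed.

Lemma heisV_Dsec_mC (v : V) (c : C) : heisV (D v *h m c) = v.
Proof. by rewrite Dsec_mCE; case: v. Qed.

Lemma mC_Dsec0 (c : C) : m c = D 0 *h m c.
Proof. by rewrite Dsec_mCE /= pairing0l (halve0 oddC) add0r. Qed.

Lemma DsecM (u v : V) : D u *h D v = D (u + v) *h m (halve (delta lam u v)).
Proof.
rewrite Dsec_mCE /delta; congr Heis => /=.
rewrite !pairingDl !pairingDr !(halveD oddC) (halveN oddC).
rewrite -[in LHS](halve_mulr2 oddC (lam u.1 v.2)) mulr2n.
move: (halve (lam u.1 u.2)) (halve (lam v.1 v.2)) => p q.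
move: (halve (lam u.1 v.2)) (halve (lam v.1 u.2)) => s t.
(* The two copies of [s] rebuild [lam u.1 v.2], and [t] cancels against [- t]. *)
rewrite [RHS](AC (2*2*2) (1*4*(2*5)*(3*6)))%AC /=.
by rewrite subrr addr0.
Qed.

Lemma delta_antisym (u v : V) : delta lam v u = - delta lam u v.
Proof. by rewrite opprB. Qed.

(** In normal-form coordinates the group is a central extension of [V] by [C] with the alternating
    cocycle [delta]/2. *)
Lemma Dsec_mCM (u v : V) (c d : C) :
  (D u *h m c) *h (D v *h m d)
    = D (u + v) *h m (halve (delta lam u v) + (c + d)).
Proof.
rewrite !mCD -(heis_mulA lam (D u)) (heis_mulA lam (m c)) mC_comm.
by rewrite !heis_mulA DsecM.
Qed.

(** The cocycle values for the two orders are opposite halves of [delta], so they differ by [delta]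
    itself. *)
Lemma Dsec_comm (u v : V) : D u *h D v = D v *h D u *h m (delta lam u v).
Proof.
rewrite !DsecM (delta_antisym u v) [v + u]addrC -heis_mulA -mCD.
congr (_ *h m _); rewrite -[X in _ + X](halve_mulr2 oddC) mulr2n addrA.
by rewrite -(halveD oddC) addNr (halve0 oddC) add0r.
Qed.

(** * From an automorphism to its pair *)

Section Aut0.
Variable phi : aut0 lam.

Lemma aut0_morphM (x y : heis A B C) : phi (x *h y) = phi x *h phi y.
Proof. by have [phiM _ _] := in_aut0P _ _ (aut0P phi); apply: phiM. Qed.

Lemma aut0_mC (c : C) : phi (m c) = m c.
Proof.
have [_ fixZ _] := in_aut0P _ _ (aut0P phi).
exact: fixZ (mC_center lam c).
Qed.

Lemma aut0_Dsec (v : V) : phi (D v) = D (bar phi v) *h m (eta_of phi v).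
Proof. exact/eta_ofP. Qed.

Lemma aut0_Dsec_mC (v : V) (c : C) :
  phi (D v *h m c) = D (bar phi v) *h m (eta_of phi v + c).
Proof. by rewrite aut0_morphM aut0_mC aut0_Dsec mCD heis_mulA. Qed.

Lemma bar_linear : linear (bar phi).
Proof.
have [_ _ lin] := in_aut0P _ _ (aut0P phi) => a u v.
by rewrite !permE lin.
Qed.

Lemma bar_delta (u v : V) : delta lam (bar phi u) (bar phi v) = delta lam u v.
Proof.
have /(congr1 phi) := Dsec_comm u v.
rewrite !aut0_morphM aut0_mC !aut0_Dsec.
set u' := bar phi u; set v' := bar phi v.
set c := eta_of phi u; set d := eta_of phi v.
(* In the central coordinates [c + d] cancels, leaving [delta u' v']/2 = -[delta u' v']/2 +
   [delta u v]. *)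
rewrite !Dsec_mCM -heis_mulA -mCD => /Dsec_mC_inj[_].
rewrite (delta_antisym u' v') [d + c]addrC addrAC => /addIr.
rewrite (halveN oddC) addrC.
move/eqP; rewrite eq_sym subr_eq -mulr2n (halve_mulr2 oddC) eq_sym.
by move/eqP.
Qed.

Lemma bar_in_sp : bar phi \in sp_pred lam.
Proof. by apply/asboolP; split; [exact: bar_linear | exact: bar_delta]. Qed.

(** By [bar_delta] the half-[delta] terms on the two sides agree and cancel. *)
Lemma eta_ofD (u v : V) : eta_of phi (u + v) = eta_of phi u + eta_of phi v.
Proof.
have /(congr1 phi) := DsecM u v.
rewrite aut0_morphM aut0_Dsec_mC !aut0_Dsec Dsec_mCM bar_delta.
by move=> /Dsec_mC_inj[_]; rewrite addrC => /addIr.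
Qed.

Lemma eta_of_in_hom : eta_of phi \in hom_pred.
Proof.
(* [zmod_morphism] is phrased with subtraction, hence the detour through [u - v + v]. *)
apply/asboolP => u v; apply/esym/eqP; rewrite subr_eq -eta_ofD.
by rewrite subrK.
Qed.

End Aut0.

Lemma bar_aut0M (phi psi : aut0 lam) (v : V) :
  bar (phi * psi)%g v = bar phi (bar psi v).
Proof. by rewrite !permE (bar_funM (aut0P phi) (aut0P psi)). Qed.

(** [psi] acts first and contributes its own central term; [phi] then acts on [D (bar psi v)]. This
    twist is the source of the reversed order in the semidirect product. *)
Lemma eta_aut0M (phi psi : aut0 lam) (v : V) :
  eta_of (phi * psi)%g v = eta_of psi v + eta_of phi (bar psi v).
Proof.
apply/esym/eta_ofP.
by rewrite aut0M aut0_Dsec aut0_Dsec_mC bar_aut0M addrC.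
Qed.

Lemma aut0_eq (phi psi : aut0 lam) :
  eta_of phi =1 eta_of psi -> bar phi =1 bar psi -> phi = psi.
Proof.
move=> eq_eta eq_bar; apply/val_inj/permP => x /=.
by rewrite (Dsec_decomp x) !aut0_Dsec_mC eq_eta eq_bar.
Qed.

(** * From a pair to an automorphism *)

Section Aut0OfPair.
Variables (f : homV A B C) (s : spV lam).

Lemma homV_addE (u v : V) : f (u + v) = f u + f v.
Proof.
have /asboolP fB := homVP f.
by apply/eqP; rewrite -subr_eq -fB addrK.
Qed.

Lemma spV_linear : linear s.
Proof. by have /asboolP[] := spVP s. Qed.

Lemma spV_addE (u v : V) : s (u + v) = s u + s v.
Proof. by have := spV_linear 1 u v; rewrite !scale1r. Qed.

Lemma spV_delta (u v : V) : delta lam (s u) (s v) = delta lam u v.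
Proof. by have /asboolP[] := spVP s. Qed.

Definition aut_fun (x : heis A B C) : heis A B C :=
  D (s (heisV x)) *h m (f (heisV x) + Dcoord x).

Lemma aut_fun_Dsec_mC (v : V) (c : C) :
  aut_fun (D v *h m c) = D (s v) *h m (f v + c).
Proof. by rewrite /aut_fun heisV_Dsec_mC Dcoord_Dsec. Qed.

(** As [heis] is finite, this suffices to make [aut_fun] a permutation. *)
Lemma aut_fun_inj : injective aut_fun.
Proof.
move=> x y; rewrite (Dsec_decomp x) (Dsec_decomp y) !aut_fun_Dsec_mC.
by move=> /Dsec_mC_inj[/perm_inj-> /addrI->].
Qed.

Lemma aut_funM (x y : heis A B C) : aut_fun (x *h y) = aut_fun x *h aut_fun y.
Proof.
rewrite (Dsec_decomp x) (Dsec_decomp y).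
rewrite Dsec_mCM !aut_fun_Dsec_mC Dsec_mCM spV_addE homV_addE spV_delta.
by rewrite addrCA (addrACA (f _)).
Qed.

Lemma aut_fun_mC (c : C) : aut_fun (m c) = m c.
Proof.
rewrite mC_Dsec0 aut_fun_Dsec_mC.
have s0 : s 0 = 0 by apply: (addrI (s 0)); rewrite -spV_addE !addr0.
have f0 : f 0 = 0 by apply: (addrI (f 0)); rewrite -homV_addE !addr0.
by rewrite s0 f0 add0r.
Qed.

Hypothesis nd : nondegenerate_pairing lam.

Lemma aut_fun_in_aut0 : in_aut0 lam (perm aut_fun_inj).
Proof.
have barE v : bar_fun (perm aut_fun_inj) v = s v.
  by rewrite /bar_fun permE heisV_Dsec_mC; case: v.
apply/in_aut0P; split=> [x y|z|a u v]; rewrite ?permE ?aut_funM //.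
  (* Non-degeneracy ensures that every central element is some [m c]. *)
  by rewrite (center_heis nd) => /imsetP[c _ ->]; rewrite aut_fun_mC.
by rewrite !barE spV_linear.
Qed.

Lemma aut0_of_pair :
  exists phi : aut0 lam, eta_of phi =1 f /\ bar phi =1 s.
Proof.
exists (Aut0 aut_fun_in_aut0); set phi := Aut0 _.
have phiE x : phi x = aut_fun x by exact: permE.
have barE v : bar phi v = s v.
  by rewrite -{1}(heisV_Dsec lam v) -heisV_bar phiE heisV_Dsec_mC heisV_Dsec.
split=> // v; apply/esym/eta_ofP; rewrite barE phiE /aut_fun heisV_Dsec.
by rewrite /Dcoord subrr addr0.
Qed.

End Aut0OfPair.

End HeisenbergAutomorphisms.

Theorem theorem6p2 (R : comNzRingType) (A B : finLmodType R) (C : finZmodType)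
    (r : nat) (lam : pairing A B C)
    (C_cyclic : cyclic [set: C]) (C_order : #|C| = r) (r_odd : odd r)
    (lam_balanced : balanced_pairing lam) (lam_nondegenerate : nondegenerate_pairing lam)
    (A_neq0 : exists a : A, a != 0) :
  exists (eta_hom : forall phi : aut0 lam, eta_of phi \in hom_pred)
         (bar_sp : forall phi : aut0 lam, bar phi \in sp_pred lam),
    anti_isomorphism (fun phi : aut0 lam =>
      HomSp (HomV (eta_hom phi)) (SpV (bar_sp phi))^-1%g).
Proof.
have oddC : odd #|C| by rewrite C_order.
exists (eta_of_in_hom oddC), (bar_in_sp oddC); split.
  apply: surj_inj_bij => [phi psi [eq_eta /invg_inj[eq_bar]]|[f s]].
    by apply: aut0_eq => v; rewrite ?eq_eta ?eq_bar.
  (* The second component of the map is the inverse of [bar phi], so a preimage of [(f, s)] must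
     induce [s^-1]. *)
  have [phi [etaE barE]] := aut0_of_pair oddC f s^-1%g lam_nondegenerate.
  exists phi; congr HomSp; first by apply/val_inj/ffunP.
  by apply: (canLR invgK); apply/val_inj/permP.
move=> phi psi; congr HomSp.
  apply/val_inj/ffunP => v; apply: etrans (esym (homVD _ _ v)).
  (* The inverse in the semidirect action undoes the inverse on [bar psi]. *)
  by rewrite hom_compE invgK /= eta_aut0M.
rewrite -invMg; congr _^-1%g; apply/val_inj/permP => v /=.
by rewrite comp_permE bar_aut0M.
Qed.
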